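(* Let $K$ be a field and let $A$ be a finite-dimensional $K$-algebra. There are only finitely many isomorphism classes of projective indecomposable $A$-modules, and only finitely many isomorphism classes of simple $A$-modules.
   Context: Conventions: $K$ is an arbitrary field (not necessarily algebraically closed). Algebras are unital but need not be commutative. ''Module'' means left $A$-module, not necessarily finitely generated. A module is simple if it is nonzero and has no submodules other than $0$ and itself. A module is indecomposable if it is nonzero and has no direct summands other than $0$ and itself. A projective indecomposable module is a module that is both projective and indecomposable (it is not assumed to be finitely generated). *)

(* Defs.v *)
From mathcomp Require Import all_boot all_algebra.
From mathcomp Require Import boolp classical_sets.

Set Implicit Arguments.
Unset Strict Implicit.
Unset Printing Implicit Defensive.

Import GRing.Theory.
Local Open Scope classical_set_scope.
Local Open Scope ring_scope.

(* algType and falgType extend nzRingType and so exclude the zero algebra; a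
   K-algebra is therefore given here as a ring, possibly zero and not necessarily
   commutative, with a morphism from K to its centre, K acting on A by
   a, x |-> fdalg_in a * x. *)
Record fdAlgebra (K : fieldType) := FDAlgebra {
  fdalg_ring :> pzRingType;
  fdalg_in : {rmorphism K -> fdalg_ring};
  fdalg_central : forall (a : K) (x : fdalg_ring),
    fdalg_in a * x = x * fdalg_in a;
  (* a finite K-basis; the dimension n may be 0 *)
  fdalg_basis : exists (n : nat) (e : 'I_n -> fdalg_ring),
    forall x : fdalg_ring,
      exists! c : 'rV[K]_n, x = \sum_i fdalg_in (c 0 i) * e i
}.

Definition is_submodule (R : pzRingType) (M : lmodType R) (N : set M) : Prop :=
  submod_closed [in N].

Definition nonzero_module (R : pzRingType) (M : lmodType R) : Prop :=
  exists x : M, x != 0.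

Definition simple_module (R : pzRingType) (M : lmodType R) : Prop :=
  nonzero_module M /\
  forall N : set M, is_submodule N -> N = [set 0] \/ N = [set: M].

Definition is_direct_summand (R : pzRingType) (M : lmodType R) (N : set M) :
    Prop :=
  is_submodule N /\
  exists N' : set M,
    [/\ is_submodule N', N `&` N' = [set 0]
      & [set u + v | u in N & v in N'] = [set: M]].

Definition indecomposable_module (R : pzRingType) (M : lmodType R) : Prop :=
  nonzero_module M /\
  forall N : set M, is_direct_summand N -> N = [set 0] \/ N = [set: M].

Definition projective_module (R : pzRingType) (P : lmodType R) : Prop :=
  forall (M N : lmodType R) (g : {linear M -> N}) (f : {linear P -> N}),
    (forall y : N, exists x : M, g x = y) ->
    exists h : {linear P -> M}, forall p : P, g (h p) = f p.

Definition projective_indecomposable_module (R : pzRingType) (P : lmodType R) :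
    Prop :=
  projective_module P /\ indecomposable_module P.

Definition isomorphic_modules (R : pzRingType) (M N : lmodType R) : Prop :=
  exists f : {linear M -> N}, bijective f.

Definition finitely_many_isoclasses (R : pzRingType)
    (C : lmodType R -> Prop) : Prop :=
  exists (n : nat) (S : 'I_n -> lmodType R),
    (forall i, C (S i)) /\
    forall M : lmodType R, C M -> exists i, isomorphic_modules M (S i).

(* Main.v *)
From HB Require Import structures.
Require Import Defs.
From mathcomp Require Import all_boot all_algebra.
From mathcomp Require Import boolp classical_sets functions.
From mathcomp Require Import zify.

(** Both halves rest on one measure: the dimension of a K-subspace of A, which
is monotone and strictly so (exists_dim).

_Simple modules._  To a left ideal I attach the class of the simple M having
some x != 0 with I x = 0; for I = 0 these are all simple modules, and for I = A
there are none.  If I != A, take a outside I with J = I + A a of least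
dimension, so that J covers I.  If J x = 0, then M lies in the class of J,
which is finite up to isomorphism by induction on the codimension.  Otherwise
a x != 0, so M = A a x, and minimality of J makes the annihilator of a x
independent of M and x: all such M are isomorphic.

_Projective indecomposable modules._  Such a P may a priori be infinitely
generated, so it has to be identified first.  Among the elements of A that do
not annihilate P, take i with i A of least dimension.  The dual basis of P
(projective_coordinates) gives a functional phi : P -> A and q with i phi(q) not
annihilating P; then i phi(q) A = i A by minimality, and after a multiplication
on the right, i phi(q) = i.  Hence phi(q) is not nilpotent, and Fitting's lemma
turns it into a nonzero idempotent e which is again a value of a functional.
This e splits off a copy of A e from P; since P is indecomposable, P is
isomorphic to A e, and e is primitive (presentation).

It remains to see that the primitive idempotents e of A give finitely many
modules A e.  For an idempotent f, consider those e that factor through f, as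
e = u f v; for f = 1 they all do.  If f is primitive, then A e and A f are
isomorphic.  If f = g + h with g and h nonzero orthogonal idempotents, then e
factors through g or through h, because e A e is a local ring, and g A and h A
are smaller than f A: induction on the dimension of f A concludes. *)

Set Implicit Arguments.
Unset Strict Implicit.
Unset Printing Implicit Defensive.

Import GRing.Theory.
Local Open Scope classical_set_scope.
Local Open Scope ring_scope.

(** * Isomorphisms, summands and classes of modules *)

Lemma ex_minimizer (T : Type) (f : T -> nat) (P : T -> Prop) :
  (exists x, P x) -> exists2 x, P x & forall y, P y -> (f x <= f y)%N.
Proof.
move=> [x0 Px0].
have exn : exists n, `[< exists2 x, P x & f x = n >].
  by exists (f x0); apply/asboolP; exists x0.
case: (ex_minnP exn) => n /asboolP[x Px <-] fx_min.
by exists x => // y Py; apply: fx_min; apply/asboolP; exists y.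
Qed.

Section Modules.
Variable R : pzRingType.
Implicit Types M N P : lmodType R.

Lemma linear_packed M N (f : M -> N) :
  linear f -> exists g : {linear M -> N}, g =1 f.
Proof.
move=> f_lin; pose mixin := GRing.isLinear.Build R M N _ f f_lin.
by pose g : {linear M -> N} := HB.pack f mixin; exists g.
Qed.

Lemma isomorphic_of_cancel M N (f : M -> N) (g : N -> M) :
  linear f -> cancel f g -> cancel g f -> isomorphic_modules M N.
Proof.
move=> /linear_packed[f' f'E] fK gK.
by exists f'; exists g => x; rewrite ?f'E ?fK // -{2}(gK x).
Qed.

Lemma is_submoduleP M (N : set M) :
  N 0 -> (forall a x y, N x -> N y -> N (a *: x + y)) -> is_submodule N.
Proof.
move=> N0 N_lin; split=> [|a x y]; first by rewrite inE.
by rewrite !inE; apply: N_lin.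
Qed.

(** Both modules are the quotient of R by the common annihilator.  Arguing with
generators avoids building that quotient. *)
Lemma isomorphic_of_ann M N (m : M) (n : N) :
  (forall z, exists a, z = a *: m) -> (forall z, exists a, z = a *: n) ->
  (forall a, a *: m = 0 <-> a *: n = 0) -> isomorphic_modules M N.
Proof.
move=> /choice[cM cME] /choice[cN cNE] annE.
have annE2 a b : a *: m = b *: m <-> a *: n = b *: n.
  split=> /eqP; rewrite -subr_eq0 -scalerBl => /eqP /annE /eqP;
  by rewrite scalerBl subr_eq0 => /eqP.
apply: (@isomorphic_of_cancel _ _ (fun z => cM z *: n) (fun z => cN z *: m)).
- move=> a x y; rewrite scalerA -scalerDl; apply/annE2.
  by rewrite scalerDl -scalerA -!cME.
- by move=> z; rewrite [RHS]cME; apply/annE2; rewrite -cNE.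
- by move=> z; rewrite [RHS]cNE; apply/annE2; rewrite -cME.
Qed.

Lemma simple_cyclic M (x : M) :
  simple_module M -> x != 0 -> forall z, exists a, z = a *: x.
Proof.
move=> [_ M_simple] x_neq0.
have [|N0|NT] := M_simple [set z | exists a, z = a *: x].
- apply: is_submoduleP => [|a _ _ [b ->] [c ->]].
    by exists 0; rewrite scale0r.
  by exists (a * b + c); rewrite scalerDl scalerA.
- have : [set z | exists a, z = a *: x] x by exists 1; rewrite scale1r.
  by rewrite N0 => /= x0; rewrite x0 eqxx in x_neq0.
- by move=> z; have : [set: M] z by []; rewrite -NT.
Qed.

(** The image and the kernel of an idempotent endomorphism are complementary
summands. *)
Lemma indecomposable_idempotent P (f : P -> P) :
  indecomposable_module P -> linear f -> (forall x, f (f x) = f x) ->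
  (forall x, f x = 0) \/ (forall x, f x = x).
Proof.
move=> [_ P_indec] /linear_packed[g gE] ff.
have gg x : g (g x) = g x by rewrite !gE.
have [|N0|NT] := P_indec [set x | g x = x].
- split.
    apply: is_submoduleP => [|a x y /= gx gy]; first by rewrite /= linear0.
    by rewrite linearP gx gy.
  exists [set x | g x = 0]; split.
  + apply: is_submoduleP => [|a x y /= gx gy]; first by rewrite /= linear0.
    by rewrite linearP gx gy scaler0 addr0.
  + apply/seteqP; split=> x /=; first by case=> gx; rewrite gx.
    by move=> ->; rewrite linear0.
  + apply/seteqP; split=> // x _; exists (g x); first exact: gg.
    by exists (x - g x); rewrite ?subrKC //= linearB gg subrr.
- left=> x; have : [set x | g x = x] (g x) by exact: gg.
  by rewrite N0 gE.
- right=> x; have : [set: P] x by [].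
  by rewrite -NT /= gE.
Qed.

Lemma finitely_many_isoclasses_iso (C : lmodType R -> Prop) :
  (forall M N, C M -> C N -> isomorphic_modules M N) ->
  finitely_many_isoclasses C.
Proof.
move=> C_iso; have [[M CM]|noC] := pselect (exists M, C M).
  by exists 1%N, (fun=> M); split=> // N CN; exists ord0; apply: C_iso.
exists 0%N, (fun=> (R^o : lmodType R)); split; first by case.
by move=> M CM; case: noC; exists M.
Qed.

Lemma finitely_many_isoclassesU (C C1 C2 : lmodType R -> Prop) :
  (forall M, C M <-> C1 M \/ C2 M) ->
  finitely_many_isoclasses C1 -> finitely_many_isoclasses C2 ->
  finitely_many_isoclasses C.
Proof.
move=> CE [n1 [S1 [CS1 S1P]]] [n2 [S2 [CS2 S2P]]].
exists (n1 + n2)%N,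
  (fun i => match fintype.split i with inl j => S1 j | inr j => S2 j end).
split=> [i|M /CE[/S1P|/S2P] [i iso_i]].
- apply/CE; case: (fintype.split i) => j; first by left; apply: CS1.
  by right; apply: CS2.
- exists (unsplit (inl i)).
  by rewrite (unsplitK (inl i : 'I_n1 + 'I_n2)).
- exists (unsplit (inr i)).
  by rewrite (unsplitK (inr i : 'I_n1 + 'I_n2)).
Qed.

End Modules.

(** * The dual basis of a projective module *)

Section DualBasis.
Variables (R : pzRingType) (P : lmodType R).

(** The pairs (c, p) in which the family of the c x *: x, for x in P, has only
finitely many nonzero terms and has sum p.  Requiring the sum over every list
that extends s makes the condition linear at once: for two pairs, concatenate
their lists. *)
Definition finite_expansion (z : (P -> R^o) * P) : bool :=
  `[< exists s : seq P, forall s', uniq s' -> {subset s <= s'} ->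
      z.2 = \sum_(x <- s') (z.1 x : R) *: x >].

Lemma finite_expansion_submod : submod_closed finite_expansion.
Proof.
split=> [|a u v].
  apply/asboolP; exists [::] => s _ _.
  by rewrite big1 // => x _; exact: scale0r.
move=> /asboolP[su suE] /asboolP[sv svE]; apply/asboolP.
exists (su ++ sv) => s s_uniq s_sub /=.
rewrite (suE s) // ?(svE s) //; last first.
- by move=> x xu; apply: s_sub; rewrite mem_cat xu.
- by move=> x xv; apply: s_sub; rewrite mem_cat xv orbT.
rewrite scaler_sumr -big_split; apply: eq_bigr => x _.
by rewrite scalerDl scalerA.
Qed.

HB.instance Definition _ :=
  GRing.isSubmodClosed.Build R _ finite_expansion finite_expansion_submod.

(** This module stands in for the free module on the set P.  Keeping the sum as a
second component makes the map to P a projection, hence visibly linear; the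
first component carries the coordinates. *)
Definition expansion_cover := {z : (P -> R^o) * P | finite_expansion z}.

HB.instance Definition _ := SubChoice.on expansion_cover.
HB.instance Definition _ := [SubChoice_isSubLmodule of expansion_cover by <:].

(** Lift the identity of P through its cover by expansions: the coordinates of
the lift are the functionals of the dual basis. *)
Lemma projective_coordinates :
  projective_module P ->
  exists phi : P -> {linear P -> R^o}, forall q, exists s : seq P,
    q = \sum_(x <- s) (phi x q : R) *: x.
Proof.
move=> P_proj.
have [|g gE] := @linear_packed R expansion_cover P (fun z => (val z).2).
  by [].
have [|h hE] := P_proj expansion_cover P g idfun.
  move=> y; have yP : finite_expansion (fun x => (x == y)%:R, y).
    apply/asboolP; exists [:: y] => s s_uniq s_y /=.
    rewrite (bigD1_seq y) ?s_y ?mem_head //= eqxx scale1r big1 ?addr0 // => x.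
    by move=> /negPf->; exact: scale0r.
  by exists (Sub _ yP); rewrite gE SubK.
have /choice[phi phiE] x : exists f : {linear P -> R^o},
    forall q, f q = (val (h q)).1 x.
  have [|f fE] := @linear_packed R P R^o (fun q => (val (h q)).1 x).
    by move=> a u v; rewrite !linearP.
  by exists f.
exists phi => q; case/asboolP: (valP (h q)) => s sE.
exists (undup s).
rewrite -[LHS]/(idfun q) -hE gE (sE (undup s)) ?undup_uniq //.
  by apply: eq_bigr => x _; rewrite phiE.
by move=> x; rewrite mem_undup.
Qed.

End DualBasis.

(** * Dimension of subspaces and the Fitting idempotent *)

Section FiniteDimension.
Variables (K : fieldType) (A : fdAlgebra K).
Implicit Types (a b x y : A) (V W : set A).

Definition subspace V : Prop :=
  V 0 /\ forall k x y, V x -> V y -> V (fdalg_in A k * x + y).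

Lemma subspace_right_multiples a : subspace [set a * b | b in [set: A]].
Proof.
split=> [|k _ _ [b _ <-] [c _ <-]]; first by exists 0; rewrite ?mulr0.
exists (fdalg_in A k * b + c) => //.
by rewrite mulrDr !mulrA fdalg_central.
Qed.

Lemma subspace_left_multiples a : subspace [set b * a | b in [set: A]].
Proof.
split=> [|k _ _ [b _ <-] [c _ <-]]; first by exists 0; rewrite ?mul0r.
by exists (fdalg_in A k * b + c); rewrite // mulrDl mulrA.
Qed.

Lemma coordinates : exists (n : nat) (c : A -> 'rV[K]_n) (d : 'rV[K]_n -> A),
  [/\ cancel c d, cancel d c
    & forall k x y, c (fdalg_in A k * x + y) = k *: c x + c y].
Proof.
have [n [e eP]] := fdalg_basis A.
pose d (v : 'rV[K]_n) := \sum_i fdalg_in A (v 0 i) * e i.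
have /choice[c cP] x : exists v, x = d v by case: (eP x) => v [vE _]; exists v.
have d_inj v w : d v = d w -> v = w.
  move=> dvw; case: (eP (d v)) => u [_ u_uniq].
  by rewrite -(u_uniq v erefl) -(u_uniq w dvw).
exists n, c, d; split=> [x|v|k x y]; first by rewrite -cP.
  by apply: d_inj; rewrite -cP.
apply: d_inj; rewrite -cP {1}(cP x) {1}(cP y) /d mulr_sumr -big_split.
by apply: eq_bigr => i _; rewrite !mxE rmorphD rmorphM mulrDl mulrA.
Qed.

(** Through coordinates, a subspace is the row space of a matrix B of largest
rank whose row space lies inside it; its dimension is the rank of B.  All that
is used later is that inclusion is detected by this number. *)
Lemma exists_dim : exists dim : set A -> nat, forall V W,
  subspace V -> subspace W -> V `<=` W ->
  (dim V <= dim W)%N /\ ((dim W <= dim V)%N -> W `<=` V).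
Proof.
have [n [c [d [cK dK cP]]]] := coordinates.
have c0 : c 0 = 0.
  by apply: (addrI (c 0)); rewrite addr0 -{1}[c 0]scale1r -cP mulr0 addr0.
have cZ k x : c (fdalg_in A k * x) = k *: c x.
  by rewrite -[_ * _]addr0 cP c0 addr0.
pose spans V (B : 'M[K]_n) := forall x, V x <-> (c x <= B)%MS.
have spansP V : exists B, subspace V -> spans V B.
  have [V_sub|] := pselect (subspace V); last by exists 0.
  have [V0 V_lin] := V_sub.
  pose inside (B : 'M[K]_n) := forall x, (c x <= B)%MS -> V x.
  (* Maximal rank is minimal corank, and every rank is at most n. *)
  have [|B B_in B_max] :=
      @ex_minimizer 'M[K]_n (fun B => n - \rank B)%N inside.
    exists 0 => x; rewrite submx0 -c0 => /eqP cx0.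
    by rewrite -(cK x) cx0 cK.
  exists B => _ x; split=> [Vx|]; last exact: B_in.
  have /B_max : inside (B + c x)%MS.
    move=> y /sub_addsmxP[[u v]] /= cyE.
    have [k vE] : exists k, v *m c x = k *: c x.
      by exists (v 0 0); rewrite -mul_scalar_mx -mx11_scalar.
    have -> : y = fdalg_in A k * x + d (u *m B).
      by rewrite -(cK y) -[RHS]cK cP dK -vE cyE addrC.
    by apply: V_lin => //; apply: B_in; rewrite dK submxMl.
  rewrite leq_subLR addnBA ?rank_leq_col // => rk_le.
  have {}rk_le : (\rank (B + c x)%MS <= \rank B)%N.
    by move: rk_le (rank_leq_col B) (rank_leq_col (B + c x)%MS); lia.
  apply: submx_trans (addsmxSr B (c x)) _.
  by rewrite -(geq_leqif (mxrank_leqif_sup (addsmxSl B (c x)))).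
have /choice[B BP] := spansP.
exists (fun V => \rank (B V)) => V W V_sub W_sub VW.
have B_le U U' : subspace U -> subspace U' -> U `<=` U' -> (B U <= B U')%MS.
  move=> U_sub U'_sub UU'; apply/row_subP => i.
  have := row_sub i (B U); rewrite -[row i _]dK => /(BP U U_sub)/UU'.
  by move=> /(BP U' U'_sub).
have BVW := B_le V W V_sub W_sub VW.
split=> [|rk_le x /(BP W W_sub) cx]; first exact: mxrankS.
apply/(BP V V_sub); apply: submx_trans cx _.
by rewrite -(geq_leqif (mxrank_leqif_sup BVW)).
Qed.

(** Both chains x^k A and A x^k decrease, hence stabilise; minimising the sum of
the two dimensions yields a single exponent for both.  Exponents are of the
form k.+1 so that the resulting idempotent is a multiple of x. *)
Lemma strongly_pi_regular x : exists k a b,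
  x ^+ k.+1 = x ^+ k.+1 * x ^+ k.+1 * a /\
  x ^+ k.+1 = b * (x ^+ k.+1 * x ^+ k.+1).
Proof.
have [dim dimP] := exists_dim.
pose r y := dim [set y * b | b in [set: A]].
pose l y := dim [set b * y | b in [set: A]].
have [|k _ k_min] := @ex_minimizer nat
    (fun k => r (x ^+ k.+1) + l (x ^+ k.+1))%N (fun=> True).
  by exists 0%N.
pose y := x ^+ k.+1; exists k; rewrite -/y.
have yyE : y * y = x ^+ (k + k.+1).+1 by rewrite -exprD.
have := k_min (k + k.+1)%N I; rewrite -/y -yyE => min_y.
have [|r_le r_eq] := dimP _ _ (subspace_right_multiples (y * y))
                             (subspace_right_multiples y).
  by move=> _ [b _ <-]; exists (y * b); rewrite ?mulrA.
have [|l_le l_eq] := dimP _ _ (subspace_left_multiples (y * y))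
                             (subspace_left_multiples y).
  by move=> _ [b _ <-]; exists (b * y); rewrite ?mulrA.
have [||a _ aE] := r_eq _ y.
- by move: min_y r_le l_le; rewrite /r /l; lia.
- by exists 1; rewrite ?mulr1.
have [||b _ bE] := l_eq _ y.
- by move: min_y r_le l_le; rewrite /r /l; lia.
- by exists 1; rewrite ?mul1r.
by exists a, b.
Qed.

(** With y = x^(k+1) = y y a = b y y, the elements y a and b y coincide, since
both equal b y y a.  This is the projection onto the part where x acts
invertibly in Fitting's decomposition: it is 0 exactly when x is nilpotent. *)
Lemma fitting_idempotent x : exists k a b,
  let e := x ^+ k.+1 * a in
  [/\ e * e = e, e = b * x ^+ k.+1 & x ^+ k.+1 * e = x ^+ k.+1].
Proof.
have [k [a [b [aE bE]]]] := strongly_pi_regular x.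
exists k, a, b; set y := x ^+ k.+1 in aE bE *.
have yab : y * a = b * y by rewrite {1}bE -!mulrA [y * (y * a)]mulrA -aE.
split=> //=; last by rewrite mulrA -aE.
by rewrite {1}yab -mulrA [y * (y * a)]mulrA -aE.
Qed.

End FiniteDimension.

(** * Projective indecomposable modules come from primitive idempotents *)

Section ProjectiveIndecomposables.
Variables (K : fieldType) (A : fdAlgebra K).
Implicit Types (P Q : lmodType A) (e f g h : A).

(** linearZ and linearP for functionals, with the action of A on itself written
as a product. *)
Lemma functionalZ P (phi : {linear P -> A^o}) a q :
  phi (a *: q) = a * phi q.
Proof. exact: linearZ. Qed.

Lemma functionalP P (phi : {linear P -> A^o}) a q r :
  phi (a *: q + r) = a * phi q + phi r.
Proof. exact: linearP. Qed.

Lemma linear_mulr P (phi : {linear P -> A^o}) a :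
  exists psi : {linear P -> A^o}, forall q, psi q = (phi q : A) * a.
Proof.
have [|psi psiE] := @linear_packed A P A^o (fun q => (phi q : A) * a).
  by move=> b u v; rewrite functionalP mulrDl -mulrA.
by exists psi.
Qed.

(** The element i is chosen among those not annihilating P so that i A has least
dimension.  Writing an element of P in the dual basis shows that i phi(q)
does not annihilate P for some functional phi and some q, so i phi(q) A = i A
contains i; the missing right factor is absorbed in phi. *)
Lemma projective_functional_fixing P :
  projective_module P -> nonzero_module P ->
  exists (phi : {linear P -> A^o}) (q : P) (i : A), i != 0 /\ i = i * phi q.
Proof.
move=> P_proj [q0 q0_neq0]; have [dim dimP] := exists_dim A.
have [phi phiE] := projective_coordinates P_proj.
have [|i [q iq_neq0] i_min] := @ex_minimizer A
    (fun i => dim [set i * b | b in [set: A]])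
    (fun i => exists q : P, i *: q != 0).
  by exists 1, q0; rewrite scale1r.
have [x itx_neq0] : exists x : P, (i * phi x q) *: x != 0.
  apply: contrapT => no_x; move/negP: iq_neq0; apply; apply/eqP.
  have [s ->] := phiE q; rewrite scaler_sumr big1 // => x _.
  by rewrite scalerA; apply/eqP/negPn/negP => itx; apply: no_x; exists x.
have [|_ sub] := dimP _ _ (subspace_right_multiples (i * phi x q))
                         (subspace_right_multiples i).
  by move=> _ [b _ <-]; exists (phi x q * b); rewrite ?mulrA.
have [||a _ aE] := sub _ i.
- by apply: i_min; exists x.
- by exists 1; rewrite ?mulr1.
have [psi psiE] := linear_mulr (phi x) a.
exists psi, q, i; rewrite psiE mulrA aE; split=> //.
by apply: contraNneq iq_neq0 => ->; rewrite scale0r.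
Qed.

Definition primitive e : Prop :=
  [/\ e != 0, e * e = e
    & forall x, x * x = x -> e * x = x -> x * e = x -> x = 0 \/ x = e].

(** An isomorphism of P with A e, given by phi and its inverse a e |-> a p. *)
Definition presents P e (phi : {linear P -> A^o}) (p : P) : Prop :=
  phi p = e /\ forall q, (phi q : A) *: p = q.

Lemma presentation P :
  projective_indecomposable_module P ->
  exists e phi p, primitive e /\ @presents P e phi p.
Proof.
move=> [P_proj P_indec]; have [P_neq0 _] := P_indec.
have [phi [q [i [i_neq0 iE]]]] := projective_functional_fixing P_proj P_neq0.
pose t : A := phi q.
(* The value t is not nilpotent, because i t^n = i for all n. *)
have [k [a [b /= [ee _ te]]]] := fitting_idempotent t.
have [e eE] : exists e, e = t ^+ k.+1 * a by exists (t ^+ k.+1 * a).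
rewrite -eE in ee te.
have e_neq0 : e != 0.
  have itE n : i * t ^+ n = i.
    by elim: n => [|n IHn]; rewrite ?mulr1 // exprSr mulrA IHn -iE.
  apply: contraNneq i_neq0 => e0.
  by rewrite -(itE k.+1) -te e0 !mulr0.
have [psi psiE] := linear_mulr phi (t ^+ k * a * e).
have psiq : psi q = e by rewrite psiE -/t !mulrA -exprS -eE ee.
have psi_e x : (psi x : A) * e = psi x by rewrite psiE -!mulrA ee.
(* Since psi p = e, the map x |-> psi(x) p is a nonzero idempotent endomorphism
   of P, hence the identity. *)
pose p := e *: q.
have psip : psi p = e by rewrite functionalZ psiq ee.
clearbody p.
have [|||eps0|epsE] := @indecomposable_idempotent A P
    (fun x => (psi x : A) *: p).
- exact: P_indec.
- by move=> c x y; rewrite functionalP scalerDl scalerA.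
- by move=> x; rewrite functionalZ psip psi_e.
- have := congr1 psi (eps0 p); rewrite functionalZ psip ee linear0 => e0.
  by rewrite e0 eqxx in e_neq0.
exists e, psi, p; split; last by split.
(* An idempotent x of e A e acts on A e by right multiplication; transported to
   P this is y |-> psi(y) x p. *)
split=> // x xx ex xe.
have [|||eps0|eps1] := @indecomposable_idempotent A P
    (fun y => ((psi y : A) * x) *: p).
- exact: P_indec.
- by move=> c y z; rewrite functionalP mulrDl scalerDl -mulrA scalerA.
- by move=> y; rewrite functionalZ psip -!mulrA [x * (e * x)]mulrA xe xx.
- left; have := eps0 p; rewrite psip ex => /(congr1 psi).
  by rewrite functionalZ psip xe linear0.
- right; have := eps1 p; rewrite psip ex => /(congr1 psi).
  by rewrite functionalZ psip xe.
Qed.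

(** Right multiplications by u and by v are inverse isomorphisms between A e and
A f. *)
Lemma isomorphic_of_equivalent P Q e f u v phi p psi q :
  @presents P e phi p -> @presents Q f psi q ->
  u * v = e -> v * u = f -> isomorphic_modules P Q.
Proof.
move=> [phip phiE] [psiq psiE] uv vu.
have phi_e x : (phi x : A) * e = phi x.
  by rewrite -{2}(phiE x) functionalZ phip.
have psi_f x : (psi x : A) * f = psi x.
  by rewrite -{2}(psiE x) functionalZ psiq.
apply: (@isomorphic_of_cancel _ _ _ (fun x => ((phi x : A) * u) *: q)
                                    (fun y => ((psi y : A) * v) *: p)).
- by move=> a x y; rewrite functionalP mulrDl scalerDl -mulrA scalerA.
- move=> x; rewrite functionalZ psiq -vu.
  rewrite -!mulrA uv [u * (v * e)]mulrA uv mulrA !phi_e.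
  exact: phiE.
- move=> y; rewrite functionalZ phip -uv.
  rewrite -!mulrA vu [v * (u * f)]mulrA vu mulrA !psi_f.
  exact: psiE.
Qed.

(** * Finiteness by splitting idempotents *)

Definition factors_through e f : Prop := exists u v, e = u * f * v.

(** Replace u and v by e u f and f v e.  Then v u is an idempotent of f A f; it
is not 0, since e = (u v)^2 = u (v u) v, so it is f. *)
Lemma factors_through_primitive e f :
  primitive e -> primitive f -> factors_through e f ->
  exists u v, u * v = e /\ v * u = f.
Proof.
move=> [e_neq0 ee _] [_ ff f_prim] [u [v eE]].
pose u' := e * u * f; pose v' := f * v * e.
have eu' : e * u' = u' by rewrite /u' !mulrA ee.
have fv' : f * v' = v' by rewrite /v' !mulrA ff.
have u'f : u' * f = u' by rewrite /u' -!mulrA ff.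
have v'e : v' * e = v' by rewrite /v' -!mulrA ee.
have uv : u' * v' = e.
  rewrite /u' /v' !mulrA -(mulrA _ f f) ff.
  by rewrite -(mulrA e u) -(mulrA e _ v) -eE !ee.
exists u', v'; split=> //.
have [|||vu0|//] := f_prim (v' * u').
- by rewrite mulrA -(mulrA v') uv v'e.
- by rewrite mulrA fv'.
- by rewrite -mulrA u'f.
case/eqP: e_neq0.
by rewrite -ee -uv mulrA -(mulrA u') vu0 mulr0 mul0r.
Qed.

(** The ring e A e is local.  The Fitting idempotent of x lies in e A e, hence is
e or 0: in the first case x is invertible in e A e; in the second x is
nilpotent, and a geometric series inverts e - x. *)
Lemma primitive_local e x :
  primitive e -> e * x = x -> x * e = x ->
  (exists w, w * x = e) \/ (exists w, w * (e - x) = e).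
Proof.
move=> [_ ee e_prim] ex xe.
have [k [a [b /= [yy yb ya]]]] := fitting_idempotent x.
have [|||y0|ye] := e_prim (x ^+ k.+1 * a) => //.
- by rewrite exprS !mulrA ex.
- by rewrite yb -mulrA exprSr -mulrA xe.
- right; exists (\sum_(i < k.+1) x ^+ i).
  have x_nil : x ^+ k.+1 = 0 by rewrite -ya y0 mulr0.
  have geom : (1 - x) * \sum_(i < k.+1) x ^+ i = 1.
    by rewrite -opprB mulNr -subrX1 x_nil sub0r opprK.
  have comm_geom : GRing.comm (1 - x) (\sum_(i < k.+1) x ^+ i).
    apply: commr_sum => i _; apply/commr_sym/commrB; first exact: commr1.
    exact/commr_sym/commrX.
  have -> : e - x = (1 - x) * e by rewrite mulrBl mul1r xe.
  by rewrite mulrA -comm_geom geom mul1r.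
- by left; exists (b * x ^+ k); rewrite -mulrA -exprSr -yb.
Qed.

Lemma primitive_factors_throughD e g h :
  primitive e -> factors_through e (g + h) ->
  factors_through e g \/ factors_through e h.
Proof.
move=> e_prim [u [v eE]]; have [_ ee _] := e_prim.
pose x := e * u * g * v * e.
have exE : e - x = e * u * h * v * e.
  apply/eqP; rewrite subr_eq addrC /x -!mulrDl -mulrDr -(mulrA e u) -(mulrA e).
  by rewrite -eE !ee.
have [||[w wE]|[w wE]] := @primitive_local e x e_prim.
- by rewrite /x !mulrA ee.
- by rewrite /x -!mulrA ee.
- by left; exists (w * e * u), (v * e); rewrite -{1}wE /x !mulrA.
- by right; exists (w * e * u), (v * e); rewrite -{1}wE exE !mulrA.
Qed.

(** The classes of modules on which the induction runs: they decrease with f,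
and 1 gives all projective indecomposable modules. *)
Definition pim_through f P : Prop :=
  projective_indecomposable_module P /\
  exists e phi p, [/\ primitive e, @presents P e phi p & factors_through e f].

Lemma pim_through_iso f P Q :
  primitive f -> pim_through f P -> pim_through f Q -> isomorphic_modules P Q.
Proof.
move=> f_prim [_ [e [phi [p [e_prim pP ef]]]]].
move=> [_ [e' [psi [q [e'_prim qP e'f]]]]].
have [u [v [uv vu]]] := factors_through_primitive e_prim f_prim ef.
have [u' [v' [uv' vu']]] := factors_through_primitive e'_prim f_prim e'f.
have [_ ee _] := e_prim; have [_ ee' _] := e'_prim.
apply: (isomorphic_of_equivalent (u := u * v') (v := u' * v) pP qP).
- by rewrite mulrA -(mulrA u) vu' -vu mulrA uv -mulrA uv.
- by rewrite mulrA -(mulrA u') vu -vu' mulrA uv' -mulrA uv'.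
Qed.

Lemma pim_throughD g h P :
  g * g = g -> h * h = h -> g * h = 0 -> h * g = 0 ->
  pim_through (g + h) P <-> pim_through g P \/ pim_through h P.
Proof.
move=> gg hh gh hg; split.
  move=> [P_pim [e [phi [p [e_prim pP /primitive_factors_throughD]]]]].
  by case=> // [eg|eh]; [left | right]; split=> //; exists e, phi, p.
case=> -[P_pim [e [phi [p [e_prim pP [u [v eE]]]]]]]; split=> //;
  exists e, phi, p; split=> //.
- by exists (u * g), v; rewrite -(mulrA u) mulrDr gg gh addr0.
- by exists (u * h), v; rewrite -(mulrA u) mulrDr hg hh add0r.
Qed.

Lemma finitely_many_pim_through f :
  f * f = f -> finitely_many_isoclasses (pim_through f).
Proof.
have [dim dimP] := exists_dim A.
pose r a := dim [set a * b | b in [set: A]].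
(* If g A = a A, then g, a left identity on g A, fixes a; so g = g a = a. *)
have r_lt a g : g * g = g -> a * g = g -> g * a = g -> g <> a -> (r g < r a)%N.
  move=> gg ag ga g_neq; rewrite ltnNge; apply/negP => rk_le.
  have [|_ sub] := dimP _ _ (subspace_right_multiples g)
                           (subspace_right_multiples a).
    by move=> _ [b _ <-]; exists (g * b); rewrite ?mulrA ?ag.
  have [|b _ aE] := sub rk_le a; first by exists 1; rewrite ?mulr1.
  by apply: g_neq; rewrite -ga -aE mulrA gg.
have [n] := ubnP (r f); elim: n f => // n IHn f.
rewrite ltnS => f_le ff.
have [[g [gg fg gf g_neq0 g_neqf]]|no_g] := pselect (exists g,
    [/\ g * g = g, f * g = g, g * f = g, g <> 0 & g <> f]).
- pose h := f - g.
  have fE : f = g + h by rewrite addrC subrK.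
  have gh : g * h = 0 by rewrite mulrBr gf gg subrr.
  have hg : h * g = 0 by rewrite mulrBl fg gg subrr.
  have hf : h * f = h by rewrite mulrBl ff gf.
  have fh : f * h = h by rewrite mulrBr ff fg.
  have hh : h * h = h by rewrite {2}/h mulrBr hf hg subr0.
  have h_neqf : h <> f.
    by move=> hE; apply: g_neq0; rewrite -(subKr f g) -/h hE subrr.
  apply: (finitely_many_isoclassesU
    (C1 := pim_through g) (C2 := pim_through h)).
  + by move=> P; rewrite {1}fE; apply: pim_throughD.
  + by apply: IHn => //; apply: leq_trans f_le; apply: r_lt.
  + by apply: IHn => //; apply: leq_trans f_le; apply: r_lt.
apply: finitely_many_isoclasses_iso => P Q PP QQ.
(* For f = 0 the class is empty, so a member P forces f to be primitive. *)
have f_neq0 : f != 0.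
  apply/eqP => f0.
  case: PP => [_ [e [phi [p [[/eqP e_neq0 _ _] _ [u [v eE]]]]]]].
  by case: e_neq0; rewrite eE f0 mulr0 mul0r.
apply: (@pim_through_iso f) => //; split=> // x xx fx xf.
apply: contrapT => /not_orP[x0 xf']; apply: no_g.
by exists x.
Qed.

Lemma finitely_many_projective_indecomposables :
  finitely_many_isoclasses (@projective_indecomposable_module A).
Proof.
suff -> : @projective_indecomposable_module A = pim_through 1.
  by apply: finitely_many_pim_through; rewrite mulr1.
apply/funext => P; apply/propext; split=> [P_pim|[]//]; split=> //.
have [e [phi [p [e_prim pP]]]] := presentation P_pim.
by exists e, phi, p; split=> //; exists e, 1; rewrite !mulr1.
Qed.

End ProjectiveIndecomposables.

(** * Simple modules *)

Section SimpleModules.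
Variables (K : fieldType) (A : fdAlgebra K).
Implicit Types (I J : set A) (M N : lmodType A).

Definition left_ideal I : Prop :=
  I 0 /\ forall a x y, I x -> I y -> I (a * x + y).

Lemma left_ideal_subspace I : left_ideal I -> subspace I.
Proof. by move=> [I0 I_lin]; split=> // k x y; apply: I_lin. Qed.

Definition adjoin I (a : A) : set A :=
  [set z | exists x b, I x /\ z = x + b * a].

Lemma left_ideal_adjoin I a : left_ideal I -> left_ideal (adjoin I a).
Proof.
move=> [I0 I_lin]; split=> [|c _ _ [x [b [Ix ->]]] [y [d [Iy ->]]]].
  by exists 0, 0; rewrite mul0r addr0.
exists (c * x + y), (c * b + d); split; first exact: I_lin.
by rewrite mulrDr mulrDl addrACA mulrA.
Qed.

Lemma sub_adjoin I a : I `<=` adjoin I a.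
Proof. by move=> x Ix; exists x, 0; rewrite mul0r addr0. Qed.

Lemma adjoin_mem I a : left_ideal I -> adjoin I a a.
Proof. by move=> [I0 _]; exists 0, 1; rewrite mul1r add0r. Qed.

Definition killed_by I M : Prop :=
  simple_module M /\ exists2 x : M, x != 0 & forall b, I b -> b *: x = 0.

Definition killed_by_not I a M : Prop :=
  simple_module M /\
  exists2 x : M, a *: x != 0 & forall b, I b -> b *: x = 0.

Lemma killed_by_adjoin I a M :
  left_ideal I ->
  killed_by I M <-> killed_by (adjoin I a) M \/ killed_by_not I a M.
Proof.
move=> I_ideal; split=> [[M_simple [x x_neq0 Ix]]|].
  have [ax0|ax_neq0] := eqVneq (a *: x) 0; last by right; split=> //; exists x.
  left; split=> //; exists x => // _ [b [c [Ib ->]]].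
  by rewrite scalerDl -scalerA ax0 scaler0 Ix // addr0.
case=> -[M_simple [x x_neq0 Ix]]; split=> //; exists x => //.
- by move=> b Ib; apply/Ix/sub_adjoin.
- by apply: contraNneq x_neq0 => ->; rewrite scaler0.
Qed.

(** The hypothesis on a says that I + A a covers I.  If b a x = 0 but b a y != 0,
then b a lies outside I because I y = 0, so I + A b a contains a and a x = 0.
Hence a x and a y have the same annihilator, and each generates its module. *)
Lemma killed_by_not_iso I a M N :
  left_ideal I ->
  (forall b, adjoin I a b -> ~ I b -> adjoin I b a) ->
  killed_by_not I a M -> killed_by_not I a N -> isomorphic_modules M N.
Proof.
move=> I_ideal a_min [M_simple [x ax_neq0 Ix]] [N_simple [y ay_neq0 Iy]].
have ann (M1 M2 : lmodType A) (x1 : M1) (x2 : M2) b :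
    (forall c, I c -> c *: x1 = 0) -> (forall c, I c -> c *: x2 = 0) ->
    a *: x1 != 0 -> b *: (a *: x1) = 0 -> b *: (a *: x2) = 0.
  move=> Ix1 Ix2 ax1_neq0 bax1; have [Iba|nIba] := pselect (I (b * a)).
    by rewrite scalerA Ix2.
  have [|c [d [Ic aE]]] := a_min (b * a) _ nIba.
    by case: I_ideal => I0 _; exists 0, b; rewrite add0r.
  move/negP: ax1_neq0; case; apply/eqP.
  by rewrite {1}aE scalerDl Ix1 // -!scalerA bax1 scaler0 addr0.
apply: (@isomorphic_of_ann _ _ _ (a *: x) (a *: y)).
- exact: simple_cyclic.
- exact: simple_cyclic.
- by move=> b; split; apply: ann.
Qed.

Lemma finitely_many_killed_by I :
  left_ideal I -> finitely_many_isoclasses (killed_by I).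
Proof.
have [dim dimP] := exists_dim A.
have T_ideal : left_ideal [set: A] by [].
pose codim I := (dim [set: A] - dim I)%N.
have dim_le I' : left_ideal I' -> (dim I' <= dim [set: A])%N.
  by move=> I'_ideal; case: (dimP _ _ (left_ideal_subspace I'_ideal)
    (left_ideal_subspace T_ideal)).
have [n] := ubnP (codim I); elim: n I => // n IHn I.
rewrite ltnS => I_le I_ideal.
have [I1|nI1] := pselect (I 1).
  apply: finitely_many_isoclasses_iso => M N [_ [x x_neq0 Ix]].
  by move: x_neq0; rewrite -[x]scale1r Ix ?eqxx.
have [|a nIa a_min] :=
    @ex_minimizer A (fun a => dim (adjoin I a)) (fun a => ~ I a).
  by exists 1.
have Ia_ideal := left_ideal_adjoin a I_ideal.
have dim_lt : (dim I < dim (adjoin I a))%N.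
  rewrite ltnNge; apply/negP => dim_ge; apply: nIa.
  have [_ sub] := dimP _ _ (left_ideal_subspace I_ideal)
    (left_ideal_subspace Ia_ideal) (@sub_adjoin I a).
  by apply: sub => //; apply: adjoin_mem.
apply: (finitely_many_isoclassesU
  (C1 := killed_by (adjoin I a)) (C2 := killed_by_not I a)).
- by move=> M; apply: killed_by_adjoin.
- apply: IHn => //; apply: leq_trans I_le.
  by have := dim_le _ Ia_ideal; rewrite /codim; lia.
apply: finitely_many_isoclasses_iso => M N.
apply: killed_by_not_iso => // b Iab nIb.
have Ib_ideal := left_ideal_adjoin b I_ideal.
have [|_ sub] := dimP _ _ (left_ideal_subspace Ib_ideal)
    (left_ideal_subspace Ia_ideal).
  move=> _ [x [c [Ix ->]]]; rewrite addrC.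
  by case: Ia_ideal => _; apply => //; apply: sub_adjoin.
by apply: sub; [apply: a_min | apply: adjoin_mem].
Qed.

Lemma finitely_many_simples :
  finitely_many_isoclasses (@simple_module A).
Proof.
suff -> : @simple_module A = killed_by [set 0].
  apply: finitely_many_killed_by; split=> // a x y -> ->.
  by rewrite mulr0 addr0.
apply/funext => M; apply/propext; split=> [M_simple|[]//]; split=> //.
have [[x x_neq0] _] := M_simple.
by exists x => // b ->; rewrite scale0r.
Qed.

End SimpleModules.

Theorem proposition9p3 (K : fieldType) (A : fdAlgebra K) :
  finitely_many_isoclasses (@projective_indecomposable_module A) /\
  finitely_many_isoclasses (@simple_module A).
Proof.
split; first exact: finitely_many_projective_indecomposables.
exact: finitely_many_simples.
Qed.
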